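(* Let $X$ and $Y$ be real normed spaces, let $C\subseteq X$ be a convex cone, and let $E=\{e_1,e_2,\dots,e_n\}$ be a (finite) basis of $C$. Let $\varphi:C\rightarrow c(Y)$ be a sublinear correspondence. Then: (i) $\varphi$ is upper semicontinuous at every point of $C$; (ii) if moreover $\varphi$ takes its values in $C$, i.e. $\varphi:C\twoheadrightarrow C$ (with $Y=X$), then for every $x\in C\setminus\{0\}$, $$\varphi(x)\subseteq\{\,l^{-1}Al(x):A\in M_{co(\varphi)}\,\}.$$
   Context: A subset $C$ of a real normed space $X$ is a cone if $tC\subseteq C$ for every $t>0$. A linearly independent set $E$ is a basis of the cone $C$ if $C$ is exactly the set of all finite combinations $\lambda_1e_1+\dots+\lambda_ne_n$ with $e_i\in E$ and $\lambda_i\ge 0$. $c(Y)$ is the set of all nonempty compact subsets of $Y$; $\varphi:C\to c(Y)$ denotes a correspondence (set-valued map) with values $\varphi(x)\in c(Y)$. It is sublinear if $\varphi(x+y)\subseteq\varphi(x)+\varphi(y)$ and $\varphi(\lambda x)=\lambda\varphi(x)$ for all $x,y\in C$, $\lambda>0$. Upper semicontinuity of $\varphi$ at $x\in C$: for every neighborhood $U$ of the set $\varphi(x)$ there is a neighborhood $V$ of $x$ in $C$ with $\varphi(z)\subseteq U$ for all $z\in V$. The linear isomorphism $l:C-C\to\mathbb{R}^n$ is $l\left(\sum_{j=1}^n\lambda_je_j\right)=(\lambda_1,\dots,\lambda_n)^T$. For a correspondence $\psi:C\twoheadrightarrow C$, $M_\psi:=l(\psi(e_1))\times\dots\times l(\psi(e_n))$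 is regarded as the set of all real $n\times n$ matrices whose $j$-th column lies in $l(\psi(e_j))$ for each $j$. $co(\varphi)$ is the correspondence $x\mapsto co(\varphi(x))$, the convex hull of $\varphi(x)$. *)

(* Defs.v *)
From HB Require Import structures.
From mathcomp Require Import all_boot all_order all_algebra.
From mathcomp Require Import all_classical all_reals all_analysis.
Set Implicit Arguments.
Unset Strict Implicit.
Unset Printing Implicit Defensive.
Import Order.TTheory GRing.Theory Num.Theory.
Import numFieldNormedType.Exports.
Local Open Scope classical_set_scope.
Local Open Scope ring_scope.

(* A correspondence C ->> Y is represented by a total function X -> set Y;
   only its values at points of C are ever constrained or used. *)

Section Cones.
Context {R : realType} {X : normedModType R}.

Definition cone (C : set X) : Prop :=
  forall t : R, 0 < t -> [set t *: x | x in C] `<=` C.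

Definition lin_indep (n : nat) (e : 'I_n -> X) : Prop :=
  forall a : 'I_n -> R, \sum_j a j *: e j = 0 -> forall j, a j = 0.

(* The finite set E is given as a family, which linear independence forces to
   be injective; a finite combination of elements of E is a combination of all
   of them, the missing coefficients being 0. *)
Definition cone_basis (n : nat) (e : 'I_n -> X) (C : set X) : Prop :=
  lin_indep e /\
  C = [set x | exists a : 'I_n -> R,
         (forall j, 0 <= a j) /\ x = \sum_j a j *: e j].

Definition linv (n : nat) (e : 'I_n -> X) (v : 'cV[R]_n) : X :=
  \sum_j v j ord0 *: e j.

(* The coordinate isomorphism l : C - C -> R^n; the value outside C - C, which
   is the span of e, is the dummy 0. *)
Definition lcoord (n : nat) (e : 'I_n -> X) (x : X) : 'cV[R]_n :=
  xget 0 [set v | linv e v = x].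

Lemma linvK (n : nat) (e : 'I_n -> X) :
  lin_indep e -> cancel (linv e) (lcoord e).
Proof.
move=> ie v; rewrite /lcoord; case: xgetP => [w _ /= wv|/(_ v)/(_ erefl)//].
apply/matrixP => i j; rewrite (ord1 j); apply/eqP; rewrite -subr_eq0; apply/eqP.
apply: (ie (fun j => w j ord0 - v j ord0)).
under eq_bigr => k _ do rewrite scalerBl.
by rewrite sumrB; apply/eqP; rewrite subr_eq0; apply/eqP.
Qed.

Lemma lcoordK (n : nat) (e : 'I_n -> X) (C : set X) :
  cone_basis e C ->
  {in [set x - y | x in C & y in C], cancel (lcoord e) (linv e)}.
Proof.
move=> [ie ->] z; rewrite inE => -[x [a [_ ->]] [y [b [_ ->]] <-]].
suff -> : \sum_j a j *: e j - \sum_j b j *: e j =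
          linv e (\col_j (a j - b j)) by rewrite linvK.
by rewrite -sumrB; apply: eq_bigr => j _; rewrite mxE scalerBl.
Qed.

Definition co {Z : Type} (phi : Z -> set X) : Z -> set X :=
  fun z => smallest (@convex_set R X) (phi z).

(* The product l(psi(e_1)) x ... x l(psi(e_n)), read columnwise. *)
Definition matset (n : nat) (e : 'I_n -> X) (psi : X -> set X) :
    set 'M[R]_n :=
  [set A | forall j, (lcoord e @` psi (e j)) (col j A)].

End Cones.

Section Correspondences.
Context {R : realType} {X Y : normedModType R}.
Implicit Types (C : set X) (phi : X -> set Y).

Definition compact_valued C phi : Prop :=
  forall x, C x -> phi x !=set0 /\ compact (phi x).

Definition sublinear_corr C phi : Prop :=
  (forall x y, C x -> C y ->
     phi (x + y) `<=` [set u + v | u in phi x & v in phi y]) /\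
  (forall (t : R) x, 0 < t -> C x -> phi (t *: x) = [set t *: u | u in phi x]).

Definition usc_at C phi (x : X) : Prop :=
  forall U : set Y, set_nbhs (phi x) U ->
    \forall z \near within C (nbhs x), phi z `<=` U.

End Correspondences.

(* Main.v *)
Require Import Defs.
From HB Require Import structures.
From mathcomp Require Import all_boot all_order all_algebra.
From mathcomp Require Import all_classical all_reals all_analysis.
From mathcomp Require Import ring lra.
Set Implicit Arguments.
Unset Strict Implicit.
Unset Printing Implicit Defensive.
Import Order.TTheory GRing.Theory Num.Theory.
Import numFieldNormedType.Exports.
Local Open Scope classical_set_scope.
Local Open Scope ring_scope.

(** Both parts rest on one fact, [sublinear_sum]: iterating the two axioms of
    sublinearity along x = \sum_j a_j e_j with a_j >= 0 gives
    phi(x) `<=` \sum_j a_j phi(e_j).  The terms with a_j = 0 cause no trouble,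
    because phi(0) is a bounded set invariant under positive scalings, hence
    reduced to 0.

    For part (ii), an element of phi(x) is thus \sum_j a_j u_j with u_j in
    phi(e_j), and the matrix whose columns are the coordinates of the u_j sends
    the coordinates of x to those of this sum.

    For part (i), the difference z - x of two points of C is in general outside
    C, so phi(z) cannot be compared with phi(x) through it.  Instead x is first
    shrunk: if z in C is close enough to x, then z - (1 - eps) x still has
    nonnegative coordinates, as a coordinate of x is either 0, where that of z
    only has to be nonnegative, or positive, where there is room eps a_j.  So
      phi(z) `<=` (1 - eps) phi(x) + phi(z - (1 - eps) x),
    and the second set lies in a small ball around 0, since by [sublinear_sum]
    the size of phi is controlled by the coordinates of its argument
    ([sublinear_bound]).  Two finiteness facts make this quantitative:
    closeness in norm controls the coordinates ([lin_indep_coord_bound]), and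
    a neighborhood of a compact set contains all its small translates
    ([set_nbhs_translate]). *)

(** * Compact sets and coordinates in normed spaces *)

Lemma set_nbhs_translate (R : realType) (Y : normedModType R) (K U : set Y) :
  compact K -> set_nbhs K U ->
  \forall v \near (0 : Y), forall k, K k -> U (k + v).
Proof.
move=> /compact_near_coveringP cK KU.
apply: (cK _ (nbhs (0 : Y)) (fun v k => U (k + v))) => k Kk.
have := @tvs.add_continuous Y (k, 0); apply => /=; rewrite addr0; exact: KU.
Qed.

(** The norm of the linear combination, as a function of the coefficients, is
    continuous and vanishes only at 0; so it has a positive minimum on the unit
    sphere of 'rV_n, which is compact, and homogeneity does the rest. *)
Lemma lin_indep_coord_bound (R : realType) (X : normedModType R) (n : nat)
    (e : 'I_n -> X) :
  lin_indep e ->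
  exists2 c : R, 0 < c & forall (a : 'I_n -> R) j,
    c * `|a j| <= `|\sum_i a i *: e i|.
Proof.
move=> ie.
pose f (v : 'rV[R]_n) := `|\sum_i v ord0 i *: e i|.
have fZ t v : f (t *: v) = `|t| * f v.
  rewrite /f -normrZ scaler_sumr; congr (`|_|).
  by apply: eq_bigr => i _; rewrite mxE scalerA.
have cf : continuous f.
  have cs : continuous (fun v : 'rV[R]_n => \sum_i v ord0 i *: e i).
    apply: (@continuous_big X _ +%R 0 predT (@tvs.add_continuous X)) => i _ w.
    apply: cvgZr_tmp; first exact: (nbhs_filter w).
    exact: coord_continuous.
  move=> v; exact: (continuous_comp (cs v) (@norm_continuous _ X _)).
pose S := [set v : 'rV[R]_n | `|v| = 1].
have nS (v : 'rV[R]_n) : v != 0 -> S (`|v|^-1 *: v).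
  move=> v0; rewrite /S /= normrZ normfV normr_id mulVf ?normr_eq0//.
have cS : compact S.
  apply: bounded_closed_compact.
    exists 1; split => // M M1 v /= ->; exact: ltW.
  have -> : S = (fun v : 'rV[R]_n => `|v|) @^-1` [set 1] by [].
  by apply: closed_comp => //; move=> v _; exact: norm_continuous.
suff [c c0 cfv] : exists2 c, 0 < c & forall v, c * `|v| <= f v.
  exists c => // a j; have := cfv (\row_i a i).
  rewrite /f; under [X in _ <= `|X| -> _]eq_bigr do rewrite mxE.
  apply: le_trans; rewrite ler_pM2l//.
  rewrite [leRHS]/Num.norm /= mx_normrE.
  by apply/bigmax_geP; right; exists (ord0, j); rewrite //= mxE.
(* The sphere is empty when n = 0. *)
have [S0|S0] := pselect (S !=set0); last first.
  exists 1 => // v; have [->|/nS Sv] := eqVneq v 0.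
    by rewrite normr0 mulr0 /f.
  by exfalso; apply: S0; eexists; exact: Sv.
have [m /set_mem Sm fm] := EVT_min_rV S0 cS (continuous_subspaceT cf).
exists (f m).
  rewrite lt_neqAle normr_ge0 andbT eq_sym /f normr_eq0; apply/eqP => /ie m0.
  move: Sm; rewrite /S /= (_ : m = 0) ?normr0; last first.
    by apply/rowP => i; rewrite m0 mxE.
  by move=> /esym/eqP; rewrite oner_eq0.
move=> v; have [->|v0] := eqVneq v 0; first by rewrite normr0 mulr0 /f.
have /fm := mem_set (nS v v0).
by rewrite fZ normfV normr_id mulrC ler_pdivlMr ?normr_gt0.
Qed.

(** * Sublinear correspondences on a convex cone *)

Section ConvexCone.
Context (R : realType) (X : normedModType R) (C : set X).
Hypotheses (hcone : cone C) (hconv : convex_set C) (C0 : C 0).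

Lemma convex_cone_add x y : C x -> C y -> C (x + y).
Proof.
move=> Cx Cy.
(* A sum is twice a midpoint. *)
have h01 : 0 <= (2^-1 : R) <= 1 by lra.
have /set_mem := hconv (Itv01 (andP h01).1 (andP h01).2) (mem_set Cx) (mem_set Cy).
rewrite /conv/= => Cm; apply: (hcone (ltr0Sn R 1)); exists (2^-1 *: x + 2^-1 *: y); last first.
  by rewrite scalerDr !scalerA divff ?scale1r.
by move: Cm; have -> : unstable.onem (2^-1 : R) = 2^-1 by rewrite /unstable.onem; lra.
Qed.

Lemma convex_cone_scale (t : R) x : 0 <= t -> C x -> C (t *: x).
Proof.
rewrite le_eqVlt => /predU1P[<-|t0] Cx; first by rewrite scale0r.
by apply: (hcone t0); exists x.
Qed.

Lemma convex_cone_sum n (v : 'I_n -> X) (a : 'I_n -> R) :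
  (forall j, C (v j)) -> (forall j, 0 <= a j) -> C (\sum_j a j *: v j).
Proof.
move=> Cv a0; elim/big_ind: _ => //; first exact: convex_cone_add.
by move=> j _; exact: convex_cone_scale.
Qed.

Section Sublinear.
Context (Y : normedModType R) (phi : X -> set Y).
Hypotheses (hcomp : compact_valued C phi) (hsub : sublinear_corr C phi).

(** If u <> 0 belonged to phi 0, then so would all its positive multiples, and
    phi 0 would be unbounded. *)
Lemma sublinear_at0 : phi 0 `<=` [set 0].
Proof.
move=> u pu; apply: contrapT => /eqP; rewrite -normr_gt0 => u0.
have [N N0 hN] := ex_strict_bound_gt0 (compact_bounded (hcomp C0).2).
have t0 : 0 < N / `|u| by exact: divr_gt0.
have : phi 0 ((N / `|u|) *: u).
  by rewrite -[X in phi X](scaler0 X (N / `|u|)) hsub.2//; exists u.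
by move=> /hN /=; rewrite normrZ gtr0_norm// divfK ?ltxx ?gt_eqF.
Qed.

Lemma sublinear_sum n (v : 'I_n -> X) (a : 'I_n -> R) (y : Y) :
  (forall j, C (v j)) -> (forall j, 0 <= a j) ->
  phi (\sum_j a j *: v j) y ->
  exists2 u : 'I_n -> Y, forall j, phi (v j) (u j) & y = \sum_j a j *: u j.
Proof.
elim: n v a y => [|n IH] v a y Cv a0.
  rewrite big_ord0 => /sublinear_at0 ->; exists (fun=> 0); last by rewrite big_ord0.
  by case.
rewrite big_ord_recl => /(hsub.1 _ _ (convex_cone_scale (a0 _) (Cv _))
  (convex_cone_sum (fun j => Cv (lift ord0 j)) (fun j => a0 (lift ord0 j)))).
move=> [w pw [z /IH[//|//|u pu ->] <-]].
(* When the coefficient is 0, any point of phi (v ord0) can be chosen, because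
   the corresponding summand is 0 by sublinear_at0. *)
have [w' pw' ->] : exists2 w', phi (v ord0) w' & w = a ord0 *: w'.
  move: (a0 ord0); rewrite le_eqVlt => /predU1P[a00|aord0].
    have [w' pw'] := (hcomp (Cv ord0)).1; exists w' => //.
    by move: pw; rewrite -a00 !scale0r => /sublinear_at0.
  by move: pw; rewrite hsub.2// => -[w' ? <-]; exists w'.
exists (fun j => if unlift ord0 j is Some k then u k else w').
  move=> j; case: unliftP => [k ->|->] //.
rewrite big_ord_recl unlift_none; congr (_ + _).
by apply: eq_bigr => j _; rewrite liftK.
Qed.

(** This replaces continuity of phi at 0: the bound depends on the finitely many
    compact sets phi (v j) only, so small coefficients force small values. *)
Lemma sublinear_bound n (v : 'I_n -> X) :
  (forall j, C (v j)) ->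
  exists2 M : R, 0 < M & forall a y, (forall j, 0 <= a j) ->
    phi (\sum_j a j *: v j) y -> `|y| <= M * \sum_j a j.
Proof.
move=> Cv.
have /choice[N hN] j : exists N : R, 0 < N /\ forall y, phi (v j) y -> `|y| <= N.
  have [N N0 hN] := ex_strict_bound_gt0 (compact_bounded (hcomp (Cv j)).2).
  by exists N; split=> // y /hN /ltW.
(* The added 1 keeps the bound positive when n = 0. *)
exists (1 + \sum_j N j).
  by rewrite ltr_wpDr// sumr_ge0// => j _; exact: ltW (hN j).1.
move=> a y a0 /sublinear_sum[//|//|u pu ->].
rewrite (le_trans (ler_norm_sum _ _ _))// mulr_sumr ler_sum// => j _.
rewrite normrZ ger0_norm// mulrC ler_wpM2r//.
rewrite (le_trans ((hN j).2 _ (pu j)))// (bigD1 j)//= addrCA lerDl.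
by rewrite addr_ge0// sumr_ge0// => k _; exact: ltW (hN k).1.
Qed.

End Sublinear.
End ConvexCone.

(** * Upper semicontinuity *)

Lemma cone_basis0 (R : realType) (X : normedModType R) (C : set X)
    (n : nat) (e : 'I_n -> X) : cone_basis e C -> C 0.
Proof.
move=> [_ ->]; exists (fun=> 0); split=> //.
by rewrite big1// => j _; rewrite scale0r.
Qed.

Lemma cone_basis_mem (R : realType) (X : normedModType R) (C : set X)
    (n : nat) (e : 'I_n -> X) : cone_basis e C -> forall j, C (e j).
Proof.
move=> [_ ->] j; exists (fun i => (i == j)%:R); split=> [i|]; first exact: ler0n.
rewrite (bigD1 j)//= eqxx scale1r big1 ?addr0// => i /negPf ->.
by rewrite scale0r.
Qed.

Lemma sublinear_usc (R : realType) (X Y : normedModType R) (C : set X)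
    (n : nat) (e : 'I_n -> X) (phi : X -> set Y) (x : X) :
  cone C -> convex_set C -> cone_basis e C ->
  compact_valued C phi -> sublinear_corr C phi ->
  C x -> usc_at C phi x.
Proof.
move=> hcone hconv hb hcomp hsub Cx U /(set_nbhs_translate (hcomp _ Cx).2).
have C0 := cone_basis0 hb; have Ce := cone_basis_mem hb.
move=> /nbhs_normP[d /= d0 hd].
have [M M0 hM] :=
  sublinear_bound hcone hconv C0 hcomp hsub Ce.
have [N N0 hN] := ex_strict_bound_gt0 (compact_bounded (hcomp _ Cx).2).
have [c c0 hc] := lin_indep_coord_bound hb.1.
have := Cx; rewrite {1}hb.2 => -[a [a0 xE]].
(* eps * B will bound the distance from a point of phi z to a point of phi x:
   the sum comes from the remainder z - (1 - eps) x, whose j-th coordinate is at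
   most eps * (2 a_j + 1), and N from replacing (1 - eps) k by k. *)
pose B := M * \sum_j (2 * a j + 1) + N.
have B0 : 0 < B.
  rewrite ltr_wpDl// mulr_ge0 ?(ltW M0)// sumr_ge0// => j _.
  by have := a0 j; lra.
pose eps := Num.min 2^-1 (d / (2 * B)).
have eps0 : 0 < eps by rewrite lt_min invr_gt0 ltr0n divr_gt0// mulr_gt0.
have eps1 : eps < 1.
  by rewrite gt_min; apply/orP; left; lra.
have epsB : eps * B < d.
  apply: (@le_lt_trans _ _ (d / (2 * B) * B)).
    by rewrite ler_pM2r// ge_min lexx orbT.
  have -> : d / (2 * B) * B = d / 2 by field; rewrite gt_eqF.
  lra.
(* The tolerance eps * a j keeps b j - (1 - eps) * a j nonnegative when a j is
   positive; when a j is 0 this holds anyway, and any positive tolerance does. *)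
pose delta j := if a j == 0 then eps else eps * a j.
have delta0 j : 0 < delta j.
  by rewrite /delta; case: eqVneq => // aj; rewrite mulr_gt0// lt_neqAle eq_sym aj a0.
have near_small : \forall z \near x, forall j, `|x - z| < c * delta j.
  apply: filter_forall => j; apply/nbhs_normP.
  by exists (c * delta j) => //=; rewrite mulr_gt0.
apply: filterS near_small => z hz Cz w pw.
have := Cz; rewrite {1}hb.2 => -[b [b0 zE]].
have hab j : `|a j - b j| < delta j.
  rewrite -(ltr_pM2l c0); apply: le_lt_trans (hz j).
  rewrite xE zE -sumrB; under [X in _ <= `|X|]eq_bigr do rewrite -scalerBl.
  exact: (hc (fun j => a j - b j)).
pose r j := b j - (1 - eps) * a j.
have hr j : 0 <= r j <= eps * (2 * a j + 1).
  have := hab j; rewrite ltr_norml /delta /r; have := a0 j; have := b0 j.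
  case: eqVneq => [->|_] bj aj /andP[? ?]; first by lra.
  have : 0 <= eps * a j by rewrite mulr_ge0 // ltW.
  lra.
have r0 j : 0 <= r j by case/andP: (hr j).
have zx : z = (1 - eps) *: x + \sum_j r j *: e j.
  rewrite xE zE scaler_sumr -big_split; apply: eq_bigr => j _ /=.
  by rewrite scalerA -scalerDl /r addrC subrK.
have eps1' : 0 < 1 - eps by rewrite subr_gt0.
have Ctx : C ((1 - eps) *: x) by apply: (hcone _ eps1'); exists x.
have Cr : C (\sum_j r j *: e j) by exact: convex_cone_sum.
move: pw; rewrite zx => /(hsub.1 _ _ Ctx Cr)[u + [v pv <-]].
rewrite hsub.2// => -[k pk <-].
have -> : (1 - eps) *: k + v = k + (v - eps *: k).
  by rewrite scalerBl scale1r -addrA [- _ + v]addrC.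
apply: hd => //=; rewrite sub0r normrN; apply: le_lt_trans epsB.
rewrite (le_trans (ler_normB _ _))// normrZ gtr0_norm// /B mulrDr.
apply: lerD; last by rewrite ler_pM2l//; exact: ltW (hN _ pk).
apply: (le_trans (hM _ _ r0 pv)).
rewrite mulrCA ler_pM2l// mulr_sumr ler_sum// => j _.
by case/andP: (hr j).
Qed.

(** * Matrix representation *)

Lemma linv_mulmx (R : realType) (X : normedModType R) (n : nat)
    (e : 'I_n -> X) (A : 'M[R]_n) (v : 'cV[R]_n) :
  linv e (A *m v) = \sum_j v j ord0 *: linv e (col j A).
Proof.
rewrite /linv; under eq_bigr do rewrite mxE scaler_suml.
rewrite exchange_big /=; apply: eq_bigr => j _.
rewrite scaler_sumr; apply: eq_bigr => i _.
by rewrite !mxE scalerA mulrC.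
Qed.

Theorem corollary2 (R : realType) (X : normedModType R) (C : set X)
    (n : nat) (e : 'I_n -> X)
    (hcone : cone C) (hconv : convex_set C) (hbasis : cone_basis e C) :
  (forall (Y : normedModType R) (phi : X -> set Y),
     compact_valued C phi -> sublinear_corr C phi ->
     forall x, C x -> usc_at C phi x) /\
  (forall phi : X -> set X,
     compact_valued C phi -> sublinear_corr C phi ->
     (forall x, C x -> phi x `<=` C) ->
     forall x, C x -> x <> 0 ->
       phi x `<=` [set linv e (A *m lcoord e x) | A in matset e (co phi)]).
Proof.
split=> [Y phi hcomp hsub x Cx|phi hcomp hsub phiC x Cx _ y].
  exact: (sublinear_usc hcone hconv hbasis hcomp hsub).
have C0 := cone_basis0 hbasis.
have Ce := cone_basis_mem hbasis.
have lK z : C z -> linv e (lcoord e z) = z.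
  move=> Cz; apply: (lcoordK hbasis); rewrite inE.
  by exists z => //; exists 0 => //; rewrite subr0.
have := Cx; rewrite {1}hbasis.2 => -[a [a0 xE]].
rewrite {1}xE.
move=> /(sublinear_sum hcone hconv C0 hcomp hsub Ce a0)[u pu ->].
exists (\matrix_(i, j) lcoord e (u j) i ord0).
  move=> j; exists (u j); first exact: (sub_gen_smallest (pu j)).
  by apply/colP => i; rewrite !mxE.
rewrite linv_mulmx; apply: eq_bigr => j _.
have -> : col j (\matrix_(i, j) lcoord e (u j) i ord0) = lcoord e (u j).
  by apply/colP => i; rewrite !mxE.
rewrite lK; last exact: (phiC _ (Ce j)).
congr (_ *: _); have -> : x = linv e (\col_j a j).
  by rewrite xE; apply: eq_bigr => i _; rewrite mxE.
by rewrite (linvK hbasis.1) mxE.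
Qed.
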